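(* Let $b \geq 3$ be an integer. Then $$\#\mathcal{N}_{b,0}(x) > x^{\rho_{b,0} + o(1)}, \quad \text{as } x \to +\infty,$$ where $$\rho_{b,0} := \sup_{\alpha_0,\dots,\alpha_{b-1}} \frac{\left(\sum_{d=0}^{b-1}\alpha_d\right)\log\left(\sum_{d=0}^{b-1}\alpha_d\right) - \sum_{d=0}^{b-1}\alpha_d\log\alpha_d}{\left(1 + \sum_{d=0}^{b-1}\alpha_d\right)\log b},$$ the supremum being taken over all real numbers $\alpha_0,\dots,\alpha_{b-1} \geq 0$ satisfying both of the following conditions: (i) for each $d \in \{2,\dots,b-1\}$, $\alpha_d = 0$ if there exists a prime $p$ with $p \mid d$ and $p \nmid b$; (ii) $\sum_{d=2}^{b-1}\alpha_d\,\nu_p(d) \leq 1$ for all primes $p \mid b$; and with the convention $0\cdot\log 0 := 0$.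
   Context: For an integer $b \geq 2$, every positive integer $n$ has a unique representation $n = \sum_{j=0}^{\ell} d_j b^j$ with $d_0,\dots,d_\ell \in \{0,\dots,b-1\}$ and $d_\ell \neq 0$; the $d_0,\dots,d_\ell$ are the base $b$ digits of $n$. Let $p_{b,0}(n)$ be the product of the nonzero base $b$ digits of $n$. For real $x \geq 1$, let $\mathcal{N}_{b,0}(x) := \{n \leq x : p_{b,0}(n) \mid n\}$, where $n$ ranges over positive integers. $\nu_p$ denotes the $p$-adic valuation and $\log$ is the natural logarithm. The notation $f(x) > x^{\rho + o(1)}$ as $x \to +\infty$ (with $b$ fixed) means that there is a function $\varepsilon(x)$ with $\varepsilon(x) \to 0$ as $x \to +\infty$ such that $f(x) > x^{\rho + \varepsilon(x)}$ for all sufficiently large $x$. *)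

(* Defs.v *)
From HB Require Import structures.
From mathcomp Require Import all_boot all_order all_algebra finmap.
From mathcomp Require Import all_classical all_reals all_analysis.

Set Implicit Arguments.
Unset Strict Implicit.
Unset Printing Implicit Defensive.

Import Order.TTheory GRing.Theory Num.Theory numFieldNormedType.Exports.

Local Open Scope classical_set_scope.
Local Open Scope ring_scope.

(* For 1 < b and 0 < n, the base b digits of n are [digit b n j] for
   j <= trunc_log b n; see [digit_expansion] and [digit_unique]. *)
Definition digit (b n j : nat) : nat := ((n %/ b ^ j) %% b)%N.

Definition nonzero_digit_prod (b n : nat) : nat :=
  (\prod_(j < (trunc_log b n).+1 | digit b n j != 0) digit b n j)%N.

Definition calN0 {R : realType} (b : nat) (x : R) : set nat :=
  [set n : nat | [/\ (0 < n)%N, n%:R <= x & (nonzero_digit_prod b n %| n)%N]].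

(* [fset_set] returns the empty set on infinite sets; [calN0 b x] is finite
   by [finite_calN0]. *)
Definition card_calN0 {R : realType} (b : nat) (x : R) : nat :=
  #|` fset_set (calN0 b x)|%fset.

Definition admissible {R : realType} (b : nat) (alpha : 'I_b -> R) : Prop :=
  [/\ forall d : 'I_b, 0 <= alpha d,
      forall d : 'I_b, (2 <= d)%N ->
        (exists p : nat, [/\ prime p, (p %| d)%N & ~~ (p %| b)%N]) ->
        alpha d = 0
    & forall p : nat, prime p -> (p %| b)%N ->
        \sum_(d < b | (2 <= d)%N) alpha d * (logn p d)%:R <= 1].

(* The convention 0 * log 0 = 0 holds because [ln] is total. *)
Definition rho0_ratio {R : realType} (b : nat) (alpha : 'I_b -> R) : R :=
  ((\sum_(d < b) alpha d) * ln (\sum_(d < b) alpha d)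
     - \sum_(d < b) alpha d * ln (alpha d))
  / ((1 + \sum_(d < b) alpha d) * ln b%:R).

(* A genuine supremum, by [has_sup_rho0]. *)
Definition rho0 (R : realType) (b : nat) : R :=
  sup [set rho0_ratio alpha | alpha in [set alpha : 'I_b -> R | admissible alpha]].

Lemma digit_lt (b n j : nat) : (1 < b)%N -> (digit b n j < b)%N.
Proof. by move=> b1; rewrite ltn_mod ltnW. Qed.

Lemma digit_expansion (b n : nat) : (1 < b)%N -> (0 < n)%N ->
  n = (\sum_(j < (trunc_log b n).+1) digit b n j * b ^ j)%N /\
  digit b n (trunc_log b n) != 0%N.
Proof.
move=> b1 n0; have b0 := ltnW b1.
have [lo hi] := andP (trunc_log_bounds b1 n0).
have E k : n = (\sum_(j < k) digit b n j * b ^ j + n %/ b ^ k * b ^ k)%N.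
  elim: k => [|k IH]; first by rewrite big_ord0 expn0 divn1 muln1.
  rewrite {1}IH big_ord_recr /= -addnA; congr addn.
  rewrite {1}(divn_eq (n %/ b ^ k) b) mulnDl addnC; congr addn.
  by rewrite -mulnA -expnS -divnMA -expnSr.
split; first by rewrite {1}(E (trunc_log b n).+1) (divn_small hi) mul0n addn0.
rewrite /digit modn_small; last by rewrite ltn_divLR ?expn_gt0 ?b0// -expnS.
by rewrite -lt0n divn_gt0 ?expn_gt0 ?b0.
Qed.

Lemma digit_unique (b l : nat) (d : nat -> nat) : (1 < b)%N ->
  (forall j, (j <= l)%N -> (d j < b)%N) -> d l != 0%N ->
  let n := (\sum_(j < l.+1) d j * b ^ j)%N in
  trunc_log b n = l /\ forall j, (j <= l)%N -> digit b n j = d j.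
Proof.
move=> b1; have b0 := ltnW b1; elim: l d => [|l IH] d dlt dl n.
  have -> : n = d 0%N by rewrite /n big_ord1 expn0 muln1.
  split; first by apply: trunc_log_eq; rewrite // expn0 expn1 lt0n dl dlt.
  by move=> [|//] _; rewrite /digit expn0 divn1 modn_small ?dlt.
set m := (\sum_(j < l.+1) d j.+1 * b ^ j)%N.
have En : n = (m * b + d 0)%N.
  rewrite /n big_ord_recl expn0 muln1 addnC big_distrl /=; congr addn.
  by apply: eq_bigr => i _; rewrite -mulnA -expnSr.
have d0b : (d 0 < b)%N by apply: dlt.
have nb : (n %/ b)%N = m by rewrite En divnMDl// divn_small// addn0.
have [Em Ed] := IH (fun j => d j.+1) (fun j => dlt j.+1) dl; rewrite -/m in Em Ed.
have m0 : (0 < m)%N.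
  rewrite /m big_ord_recr /= addn_gt0; apply/orP; right.
  by rewrite muln_gt0 lt0n dl expn_gt0 b0.
split.
  have [lo hi] := andP (trunc_log_bounds b1 m0); rewrite Em in lo hi.
  apply: trunc_log_eq => //; apply/andP; split.
    by rewrite expnSr -leq_divRL// nb.
  by rewrite expnSr -ltn_divLR// nb.
move=> [|j] jl; first by rewrite /digit expn0 divn1 En modnMDl modn_small.
by rewrite /digit expnS divnMA nb; apply: Ed.
Qed.

Lemma finite_calN0 (R : realType) (b : nat) (x : R) : finite_set (calN0 b x).
Proof.
apply: (sub_finite_set _ (finite_II (Num.truncn x).+1)) => n [n0 nx _] /=.
have x0 : 0 <= x by apply: le_trans nx; rewrite ler0n.
by rewrite ltnS truncn_ge_nat.
Qed.

Lemma has_sup_rho0 (R : realType) (b : nat) : (1 < b)%N ->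
  has_sup [set rho0_ratio alpha | alpha in
             [set alpha : 'I_b -> R | admissible alpha]].
Proof.
move=> b1; have lb : 0 < ln (b%:R : R) by rewrite ln_gt0// ltr1n.
have b0 : 0 < (b%:R : R) by rewrite ltr0n ltnW.
split.
  exists (rho0_ratio (fun _ : 'I_b => 0 : R)); exists (fun _ => 0) => //=.
  by split=> // p _ _; rewrite big1 ?ler01// => i _; rewrite mul0r.
exists 1 => _ [a [a0 _ _] <-]; rewrite /rho0_ratio; set S := \sum_(d < b) a d.
have S0 : 0 <= S by apply: sumr_ge0.
have D0 : 0 < 1 + S by rewrite ltr_pwDl.
rewrite ler_pdivrMr ?mulr_gt0// mul1r.
apply: (@le_trans _ _ (S * ln b%:R)); last by rewrite ler_pM2r// lerDr ler01.
have [S_eq0|Sn0] := eqVneq S 0.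
  rewrite S_eq0 !mul0r sub0r big1 ?oppr0// => i _.
  have /allP/(_ i) : all (fun d => true ==> (a d == 0)) (index_enum 'I_b).
    by rewrite -psumr_eq0 ?S_eq0// -/S S_eq0.
  by rewrite mem_index_enum => /(_ isT) /eqP ->; rewrite mul0r.
have Sp : 0 < S by rewrite lt_neqAle eq_sym Sn0.
rewrite -subr_le0 -addrAC -mulrBr -ln_div ?posrE// {1}/S mulr_suml -sumrB.
apply: (@le_trans _ _ (\sum_(d < b) (S / b%:R - a d))).
  apply: ler_sum => i _; have [->|ai0] := eqVneq (a i) 0.
    by rewrite !mul0r !subr0 divr_ge0// ltW.
  have ai : 0 < a i by rewrite lt_neqAle eq_sym ai0 a0.
  rewrite -mulrBr -ln_div ?posrE ?divr_gt0//.
  have := le_ln1Dx (x := S / b%:R / a i - 1).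
  rewrite addrCA subrr addr0 => H.
  apply: (@le_trans _ _ (a i * (S / b%:R / a i - 1))).
    by rewrite ler_pM2l// H// ltrBDr addNr ?divr_gt0.
  by rewrite mulrBr mulr1 [a i * _]mulrC divfK.
rewrite sumrB sumr_const card_ord -/S -[_ *+ b]mulr_natr divfK ?subrr//.
by rewrite gt_eqF.
Qed.

(* Main.v *)
Require Import Defs.
From mathcomp Require Import all_boot all_order all_algebra finmap.
From mathcomp Require Import all_classical all_reals all_analysis.
From mathcomp Require Import ring lra.
Import Order.TTheory GRing.Theory Num.Theory numFieldNormedType.Exports.
Local Open Scope classical_set_scope.
Local Open Scope ring_scope.

(** Given an admissible alpha and an integer k, let N_d = floor(alpha_d k) and
    consider the integers whose base b expansion is a leading 1, then a word
    with exactly N_d letters d for each d, then k zeros. The product of the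
    nonzero digits is the product of the d^(N_d), which divides b^k by (i) and
    (ii), hence divides the integer. These integers are at most
    b^((k + 1)(1 + sum alpha_d)) and there are multinomially many of them, so
    Stirling's formula up to O(log k) in the exponent gives the ratio attached
    to alpha; then take the supremum over alpha. *)

(** * Counting words with prescribed letter counts *)

(** Words starting with [x] continue with a rearrangement of [rem x s], and the letter counts add up
    to [size s]. Letters of [u] absent from [s] contribute 0! = 1, so [u] can be the whole
    alphabet. *)
Lemma size_permutations_count (T : eqType) (s u : seq T) :
  uniq u -> {subset s <= u} ->
  (size (permutations s) * \prod_(x <- u) (count_mem x s)`!)%N = (size s)`!.
Proof.
move=> uu; have [n] := ubnP (size s); elim: n s => // n IH s sn su.
have [s0|s0] := posnP (size s).
  by rewrite (size0nil s0) /= big1.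
rewrite (perm_size (permutationsE s0)) size_allpairs_dep sumnE big_map.
rewrite big_distrl /= (eq_big_seq (fun x => (count_mem x s * (size s).-1`!)%N)).
  rewrite -big_distrl /= -{2}(prednK s0) factS (prednK s0); congr muln.
  rewrite -(perm_size (perm_count_undup s)) size_flatten sumnE !big_map.
  by apply: eq_bigr => x _; rewrite size_nseq.
move=> x; rewrite mem_undup => xs.
rewrite (bigD1_seq x (su _ xs) uu) /=.
have c0 : (0 < count_mem x s)%N by rewrite -has_count has_pred1.
rewrite -(prednK c0) factS -mulnA mulnCA; congr muln.
rewrite -(size_rem xs) -IH; first last.
- by move=> y /mem_rem /su.
- by rewrite size_rem//; case: (size s) s0 sn.
rewrite (bigD1_seq x (su _ xs) uu) /= count_mem_rem eqxx subn1; congr muln.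
congr muln.
apply: eq_bigr => y; rewrite eq_sym => /negbTE yx.
by rewrite count_mem_rem yx subn0.
Qed.

(** * Integers with a prescribed digit word *)

Definition digits (b n : nat) : seq nat := mkseq (digit b n) (trunc_log b n).+1.

(** Least significant digit first: a prefix of zeros multiplies by a power of [b], and the leading
    digit is the last entry. *)
Definition value (b : nat) (e : seq nat) : nat :=
  (\sum_(j < size e) nth 0%N e j * b ^ j)%N.

Lemma nonzero_digit_prodE (b n : nat) :
  nonzero_digit_prod b n = (\prod_(d <- digits b n | d != 0) d)%N.
Proof.
rewrite /nonzero_digit_prod /digits big_map -[(trunc_log b n).+1]subn0.
by rewrite -/(index_iota _ _) big_mkord subn0.
Qed.

Lemma valueK (b : nat) (e : seq nat) : (1 < b)%N ->
  all (gtn b) e -> last 0%N e != 0%N -> digits b (value b e) = e.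
Proof.
move=> b1 eb el.
have e0 : (0 < size e)%N by case: e el eb.
rewrite /value; case E : (size e) => [|l]; first by rewrite E in e0.
have := @digit_unique b l (nth 0%N e) b1; rewrite /digits.
case=> [j jl||-> H].
- by apply: (allP eb); rewrite mem_nth// E.
- by rewrite -[l]/(l.+1.-1) -E nth_last.
apply: (@eq_from_nth _ 0%N); rewrite size_mkseq// => i il.
by rewrite nth_mkseq// H.
Qed.

Lemma value_lt (b : nat) (e : seq nat) :
  (0 < b)%N -> all (gtn b) e -> (value b e < b ^ size e)%N.
Proof.
move=> b0; elim/last_ind: e => [|e d IH]; first by rewrite /value big_ord0.
rewrite all_rcons => /andP[/= db /IH h].
rewrite /value size_rcons big_ord_recr /= nth_rcons ltnn eqxx expnS.
under eq_bigr => i _ do rewrite nth_rcons ltn_ord.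
apply: leq_trans (_ : d.+1 * b ^ size e <= _)%N; last by rewrite leq_mul2r db orbT.
by rewrite mulSn ltn_add2r.
Qed.

Lemma dvdn_value_zeros (b k : nat) (e : seq nat) :
  (b ^ k %| value b (nseq k 0 ++ e))%N.
Proof.
apply: dvdn_sum => i _; rewrite nth_cat size_nseq.
case: ltnP => ik; first by rewrite nth_nseq ik.
by rewrite dvdn_mull// dvdn_exp2l.
Qed.

(** Valuations are compared prime by prime; the digit 1 has valuation 0, so the sums may start at
    2. *)
Lemma prod_digits_dvdn (b k : nat) (N : 'I_b -> nat) : (0 < b)%N ->
  (forall p, prime p ->
     (\sum_(d < b | (2 <= d)%N) N d * logn p d <= k * logn p b)%N) ->
  (\prod_(d < b | d != 0%N :> nat) d ^ N d %| b ^ k)%N.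
Proof.
move=> b0 H.
have P0 (d : 'I_b) : d != 0%N :> nat -> (0 < d ^ N d)%N.
  by rewrite expn_gt0 -lt0n => ->.
apply/dvdn_partP; first exact: prodn_cond_gt0.
move=> p; rewrite mem_primes => /andP[pp _].
rewrite p_part pfactor_dvdn ?expn_gt0 ?b0// lognX.
apply: leq_trans (H _ pp).
have -> : logn p (\prod_(d < b | d != 0%N :> nat) d ^ N d)%N
   = (\sum_(d < b | d != 0%N :> nat) logn p (d ^ N d))%N.
  (* Positivity is carried along, since [lognM] needs positive factors. *)
  apply: (@proj1 _ (0 < \prod_(d < b | d != 0%N :> nat) d ^ N d)%N).
  apply: (big_ind2 (fun m n => logn p m = n /\ 0 < m)%N) => //.
  - by rewrite logn1.
  - by move=> x1 x2 y1 y2 [<- x0] [<- y0]; rewrite lognM// muln_gt0 x0.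
  - by move=> d /P0.
rewrite [leqLHS]big_mkcond [leqRHS]big_mkcond.
apply: leq_sum => -[[|[|d]] ?] _ //=.
  by rewrite lognX logn1 muln0.
by rewrite lognX.
Qed.

(** Division-free multinomial bound: distinct rearrangements of one word give distinct elements of
    [calN0 b x]. *)
Lemma fact_le_card_calN0 (R : realType) (b k : nat) (N : 'I_b -> nat) (x : R) :
  (1 < b)%N ->
  (forall p, prime p ->
     (\sum_(d < b | (2 <= d)%N) N d * logn p d <= k * logn p b)%N) ->
  (b ^ (k + \sum_(d < b) N d).+1)%:R <= x ->
  ((\sum_(d < b) N d)`! <= card_calN0 b x * \prod_(d < b) (N d)`!)%N.
Proof.
move=> b1 H bx; have b0 := ltnW b1.
pose s := flatten [seq nseq (N d) d | d <- index_enum 'I_b].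
have sN d : count_mem d s = N d.
  rewrite count_flatten -map_comp sumnE big_map (bigD1 d)//=.
  rewrite count_nseq /= eqxx mul1n.
  by rewrite big1 ?addn0// => i /negbTE id; rewrite count_nseq /= id.
have sS : size s = (\sum_(d < b) N d)%N.
  rewrite size_flatten /shape -map_comp sumnE big_map.
  by apply: eq_bigr => d _ /=; rewrite size_nseq.
rewrite -sS.
rewrite -(@size_permutations_count _ s (index_enum 'I_b)) ?index_enum_uniq//; last first.
  by move=> d _; exact: mem_index_enum.
under eq_bigr => d _ do rewrite sN.
rewrite leq_mul2r; apply/orP; right.
(* The final 1 is the leading digit: it keeps the expansion valid when [w] ends in 0 and leaves the
   digit product unchanged. *)
pose e (w : seq 'I_b) := nseq k 0%N ++ rcons (map val w) 1%N.
have eb w : all (gtn b) (e w).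
  rewrite all_cat all_nseq/= b0 orbT all_rcons/= b1 /=.
  by apply/allP => _ /mapP[d _ ->]; exact: ltn_ord.
have el w : last 0%N (e w) != 0%N by rewrite last_cat last_rcons.
rewrite -(size_map (fun w => value b (e w))); apply: uniq_leq_size.
  rewrite map_inj_uniq ?permutations_uniq// => w1 w2 /(congr1 (digits b)).
  rewrite !valueK// => /eqP; rewrite eqseq_cat//.
  move=> /andP[_ /eqP] /rcons_inj [].
  exact: inj_map val_inj _ _.
move=> n /mapP[w]; rewrite mem_permutations => ws ->{n}.
rewrite in_fset_set; last exact: finite_calN0.
have ps : (nonzero_digit_prod b (value b (e w))
           = \prod_(d < b | d != 0%N :> nat) d ^ N d)%N.
  rewrite nonzero_digit_prodE valueK// big_cat/= [X in (X * _)%N]big1_seq ?mul1n; last first.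
    by move=> d; rewrite mem_nseq => /and3P[d0 _ /eqP dE]; rewrite dE in d0.
  rewrite big_rcons /= muln1 big_map.
  rewrite (perm_big _ ws)/= big_flatten big_map [RHS]big_mkcond.
  apply: eq_bigr => d _; rewrite big_nseq_cond.
  by case: ifP => //= _; rewrite iter_muln_1.
rewrite inE; split.
(* If the value were 0, its digit list would be the single entry 0, against [el]. *)
- rewrite lt0n; apply: contraTneq (el w).
  rewrite -[in X in last _ X](valueK b (e w) b1 (eb w) (el w)) => ->.
  by rewrite /digits trunc_log0 /= /digit div0n mod0n.
- apply: le_trans bx; rewrite ler_nat ltnW//.
  have -> : (k + \sum_(d < b) N d).+1 = size (e w).
    by rewrite size_cat size_nseq size_rcons size_map (perm_size ws) sS addnS.
  exact: value_lt.
rewrite ps; apply: dvdn_trans (dvdn_value_zeros _ _ _).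
exact: prod_digits_dvdn.
Qed.

(** * Logarithmic estimates *)

(** This is [ln (1 + t) <= t] at [t = y / x - 1], the tangent inequality behind most estimates
    below. *)
Lemma mulr_sub_ln_le (R : realType) (x y : R) :
  0 <= x -> 0 < y -> x * (ln y - ln x) <= y - x.
Proof.
rewrite le_eqVlt => /predU1P[<- y0|x0 y0]; first by rewrite mul0r subr0 ltW.
rewrite -ln_div ?posrE//.
have := @le_ln1Dx R (y / x - 1).
rewrite addrCA subrr addr0 => H.
have {}H : ln (y / x) <= y / x - 1 by apply: H; rewrite ltrBDr addNr divr_gt0.
apply: (le_trans (ler_wpM2l (ltW x0) H)).
by rewrite mulrBr mulr1 mulrC divfK ?gt_eqF.
Qed.

Lemma ln_fact_ge (R : realType) (n : nat) :
  n%:R * ln n%:R - n%:R <= ln (n`!%:R : R).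
Proof.
elim: n => [|n IH]; first by rewrite fact0 ln1 mul0r subr0.
have n0 : 0 <= (n%:R : R) by [].
have s0 : 0 < (n.+1%:R : R) by rewrite ltr0n.
rewrite factS natrM lnM ?posrE ?ltr0n ?fact_gt0//.
have := mulr_sub_ln_le R _ _ n0 s0.
rewrite -natr1; lra.
Qed.

Lemma ln_fact_le (R : realType) (n : nat) :
  ln (n`!%:R : R) <= n.+1%:R * ln n%:R - n%:R + 1.
Proof.
elim: n => [|n IH]; first by rewrite fact0 ln1 ln0// mulr0 subr0 add0r.
rewrite factS natrM lnM ?posrE ?ltr0n ?fact_gt0//.
(* The step from 0 to 1 is separate, because the tangent inequality needs [0 < y]. *)
case: n IH => [|n] IH; first by rewrite fact0 !ln1 mulr0 sub0r addNr addr0.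
have n0 : 0 < (n.+1%:R : R) by rewrite ltr0n.
have s0 : 0 <= (n.+2%:R : R) by [].
have := mulr_sub_ln_le R _ _ s0 n0.
move: IH; rewrite -[n.+3%:R]natr1 -[n.+2%:R]natr1; lra.
Qed.

(** The function t ln t is negative on (0, 1): the [+ 1] covers [n = 0], while for positive [n] both
    factors increase. *)
Lemma nat_mul_ln_le (R : realType) (n : nat) (y : R) :
  n%:R <= y -> n%:R * ln n%:R <= y * ln y + 1.
Proof.
case: n => [|n] ny.
  have := mulr_sub_ln_le R _ _ ny ltr01.
  by rewrite ln1 mul0r; lra.
have n0 : 0 < (n.+1%:R : R) by rewrite ltr0n.
have n1 : 1 <= (n.+1%:R : R) by rewrite ler1n.
have y0 := lt_le_trans n0 ny.
have l0 : 0 <= ln (n.+1%:R : R) by apply: ln_ge0.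
have l : ln (n.+1%:R : R) <= ln y by rewrite ler_ln ?posrE.
apply: le_trans (_ : y * ln y <= _); last by rewrite lerDl.
exact: ler_pM.
Qed.

Lemma mul_ln_scale (R : realType) (x k : R) : 0 <= x -> 0 < k ->
  x * k * ln (x * k) = k * (x * ln x) + x * (k * ln k).
Proof.
rewrite le_eqVlt => /predU1P[<- _|x0 k0]; first by rewrite !mul0r mulr0 addr0.
by rewrite lnM ?posrE//; ring.
Qed.

(** Turns logarithmic errors into linear ones of arbitrarily small slope; [K] comes from the tangent
    inequality applied to [e * y]. *)
Lemma ln_le_linear (R : realType) (e : R) : 0 < e ->
  exists2 K, 0 <= K & forall y, 0 <= y -> ln y <= e * y + K.
Proof.
move=> e0; exists `|ln e| => // y; rewrite le_eqVlt => /predU1P[<-|y0].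
  by rewrite ln0// mulr0 add0r.
have ey0 : 0 < e * y by rewrite mulr_gt0.
have := mulr_sub_ln_le R _ _ ler01 ey0.
rewrite ln1 lnM ?posrE// => H.
have := ler_norm (- ln e); rewrite normrN; lra.
Qed.

(** Logarithms in the error terms are at most [B = e * M + K + 1], and rounding loses at most 1 per
    letter, so the error is a multiple of [b * B]. *)
Lemma ln_multinomial_ge (R : realType) (b k : nat) (alpha : 'I_b -> R) (e K : R) :
  (forall d, 0 <= alpha d) -> 0 <= e -> 0 <= K ->
  (forall y, 0 <= y -> ln y <= e * y + K) ->
  let S := \sum_(d < b) alpha d in
  let N d := Num.truncn (alpha d * k%:R) in
  (k%:R * (S * ln S - \sum_(d < b) alpha d * ln (alpha d))
    - 4 * b%:R * (e * (S * k%:R) + K + 1)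
  <= ln (((\sum_(d < b) N d)`!)%:R : R) - \sum_(d < b) ln ((N d)`!%:R : R) : Prop).
Proof.
move=> a0 e0 K0 lnK S N.
set L := (\sum_(d < b) N d)%N; set M := S * k%:R; set B := e * M + K + 1.
have S0 : 0 <= S by apply: sumr_ge0.
have M0 : 0 <= M by apply: mulr_ge0.
have ak0 d : 0 <= alpha d * k%:R by apply: mulr_ge0.
have ME : M = \sum_(d < b) alpha d * k%:R by rewrite -mulr_suml.
have LE : L%:R = \sum_(d < b) (N d)%:R :> R by rewrite natr_sum.
have bE : b%:R = \sum_(d < b) 1 :> R by rewrite sumr_const card_ord.
have Na d : (N d)%:R <= alpha d * k%:R by rewrite truncn_le.
have aN d : alpha d * k%:R <= (N d)%:R + 1.
  by rewrite natr1 ltW//; have /andP[] := truncn_itv (ak0 d).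
have LM : L%:R <= M by rewrite ME LE; apply: ler_sum.
have ML : M - L%:R <= b%:R.
  rewrite lerBlDl ME LE bE -big_split/=.
  exact: ler_sum.
have B1 : 1 <= B by rewrite lerDr addr_ge0// mulr_ge0.
have lnM1 : ln M + 1 <= B by rewrite lerD2r lnK.
have lnN d : ln ((N d)%:R : R) <= B.
  have : (N d)%:R <= M.
    apply: le_trans LM; rewrite LE (bigD1 d)//= lerDl; exact: sumr_ge0.
  move=> /(ler_wpM2l e0); have := lnK (N d)%:R (ler0n _ _); rewrite /B; lra.
have up : \sum_(d < b) ln ((N d)`!%:R : R) <=
    \sum_(d < b) (alpha d * k%:R) * ln (alpha d * k%:R) - L%:R + b%:R * (B + 2).
  rewrite LE bE mulr_suml -sumrB -big_split/=.
  apply: ler_sum => d _; apply: le_trans (ln_fact_le _ _) _.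
  have := nat_mul_ln_le _ _ _ (Na d); have := lnN d.
  by rewrite -natr1; lra.
(* t ln t lies above its tangent at M, of slope ln M + 1. *)
have LL : M * ln M - b%:R * B <= L%:R * ln (L%:R : R).
  have [M00|Mn0] := eqVneq M 0.
    have -> : L%:R = 0 :> R by apply/le_anti; rewrite -{1}M00 LM /=.
    by rewrite M00 !mul0r sub0r oppr_le0 mulr_ge0// (le_trans ler01).
  have Mp : 0 < M by rewrite lt_neqAle eq_sym Mn0.
  have := mulr_sub_ln_le R _ _ (ler0n R L) Mp.
  have : (M - L%:R) * (ln M + 1) <= b%:R * B.
    apply: le_trans (_ : (M - L%:R) * B <= _).
      by rewrite ler_wpM2l// subr_ge0.
    by rewrite ler_wpM2r// (le_trans ler01).
  lra.
(* The terms in k ln k cancel by homogeneity. *)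
have scale : M * ln M - \sum_(d < b) (alpha d * k%:R) * ln (alpha d * k%:R) =
    k%:R * (S * ln S - \sum_(d < b) alpha d * ln (alpha d)).
  have [k0|k0] := posnP k.
    rewrite /M k0 !mulr0 !mul0r big1 ?subrr// => d _.
    by rewrite !mulr0 mul0r.
  have kR : 0 < (k%:R : R) by rewrite ltr0n.
  rewrite (mul_ln_scale _ _ _ S0 kR).
  under eq_bigr => d _ do rewrite (mul_ln_scale _ _ _ (a0 d) kR).
  rewrite big_split/= -mulr_suml -mulr_sumr -/S; ring.
(* The terms [L] cancel; the errors [b * B] and [b * (B + 2)] add up to at most [4 * b * B] since
   [1 <= B]. *)
have := ln_fact_ge R L.
rewrite -scale; have := ler_wpM2l (ler0n R b) B1; lra.
Qed.

(** * The lower bound attached to one admissible alpha *)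

Lemma card_calN0_gt0 (R : realType) (b : nat) (x : R) :
  1 <= x -> (0 < card_calN0 b x)%N.
Proof.
move=> x1; rewrite /card_calN0 cardfs_gt0; apply/fset0Pn; exists 1%N.
rewrite in_fset_set ?inE; last exact: finite_calN0.
split=> //; rewrite /nonzero_digit_prod trunc_log1 big_mkcond big_ord1.
by rewrite /digit expn0 divn1; case: b => [|[|[|b]]].
Qed.

Lemma near_pinfty_le_ln (R : realType) (A : R) :
  \forall x \near +oo, A <= ln x.
Proof.
near=> x.
have Ax : expR A <= x by near: x; apply: nbhs_pinfty_ge; exact: num_real.
by rewrite -[A]expRK ler_ln ?posrE ?expR_gt0// (lt_le_trans (expR_gt0 A)).
Unshelve. all: by end_near. Qed.

(** For [p] not dividing [b], condition (i) kills every term; for [p] dividing [b], condition (ii)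
    bounds the sum by [k], and [logn p b] is at least 1. *)
Lemma admissible_truncn (R : realType) (b k : nat) (alpha : 'I_b -> R) :
  admissible alpha -> forall p, prime p ->
  (\sum_(d < b | (2 <= d)%N) Num.truncn (alpha d * k%:R) * logn p d
     <= k * logn p b)%N.
Proof.
case=> a0 a1 a2 p pp; have [pb|npb] := boolP (p %| b)%N; last first.
  rewrite big1// => d d2; have [pd|npd] := boolP (p %| d)%N.
    by rewrite a1 ?mul0r ?truncn0//; exists p.
  by rewrite lognE (negbTE npd) !andbF muln0.
have [b0|b0] := posnP b.
  by rewrite big1 // => -[d dlt]; exfalso; rewrite b0 in dlt.
apply: leq_trans (_ : k * 1 <= _)%N; last first.
  by rewrite leq_mul2l logn_gt0 mem_primes pp b0 pb orbT.
rewrite muln1 -(ler_nat R) natr_sum.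
apply: le_trans (_ : k%:R * \sum_(d < b | (2 <= d)%N) alpha d * (logn p d)%:R <= _).
  rewrite mulr_sumr; apply: ler_sum => d _.
  by rewrite natrM mulrA [k%:R * _]mulrC ler_wpM2r// truncn_le mulr_ge0.
by rewrite ler_piMr// a2.
Qed.

Lemma card_calN0_lower (R : realType) (b : nat) (alpha : 'I_b -> R) (delta : R) :
  (1 < b)%N -> admissible alpha -> 0 < delta ->
  \forall x \near +oo,
    (rho0_ratio alpha - delta) * ln x <= ln (card_calN0 b x)%:R.
Proof.
move=> b1 adm delta0; have [a0 _ _] := adm.
rewrite /rho0_ratio; set S := \sum_(d < b) alpha d.
set E := S * ln S - _; set c := (1 + S) * ln _.
have S0 : 0 <= S by apply: sumr_ge0.
have lb : 0 < ln (b%:R : R) by rewrite ln_gt0// ltr1n.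
have c0 : 0 < c by rewrite mulr_gt0// ltr_pwDl.
have b0 : 0 < (b%:R : R) by rewrite ltr0n ltnW.
(* If [E <= 0] the left side is eventually nonpositive, and a nonempty set suffices. *)
have [Epos|Eneg] := ltP 0 E; last first.
  near=> x.
  have x1 : 1 <= x by near: x; apply: nbhs_pinfty_ge; exact: num_real.
  apply: (@le_trans _ _ 0).
    rewrite mulr_le0_ge0 ?ln_ge0// subr_le0 (le_trans _ (ltW delta0))//.
    by rewrite mulr_le0_ge0// invr_ge0 ltW.
  by rewrite ln_ge0// ler1n card_calN0_gt0.
(* Chosen so that the linear error costs at most half of [delta * ln x]; [S + 1] avoids dividing by
   0. *)
pose e := delta * c / (8 * b%:R * (S + 1)).
have S1 : 0 < S + 1 by rewrite ltr_wpDl.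
have D0 : 0 < 8 * b%:R * (S + 1) by rewrite !mulr_gt0.
have e0 : 0 < e by rewrite divr_gt0// mulr_gt0.
have [K K0 lnK] := ln_le_linear R e e0.
near=> x.
have x1 : 1 <= x by near: x; apply: nbhs_pinfty_ge; exact: num_real.
have xc : c <= ln x by near: x; exact: near_pinfty_le_ln.
(* The other half of [delta * ln x] pays for the constants; [2 * E] is the loss from [t - 2 < k]. *)
have xd : (2 * E + 4 * b%:R * (K + 1)) * 2 / delta <= ln x.
  by near: x; exact: near_pinfty_le_ln.
have x0 : 0 < x by apply: lt_le_trans x1.
set t := ln x / c.
have t1 : 1 <= t by rewrite ler_pdivlMr// mul1r.
have tx : ln x = t * c by rewrite divfK ?gt_eqF.
have t0 : 0 <= t by apply: le_trans t1.
have m0 : (0 < Num.truncn t)%N by rewrite truncn_gt0.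
(* Taking [k + 1] as the floor of [t] leaves room for the leading 1: the length [k + 1 + \sum_d N d]
   is at most [(1 + S) * t]. *)
have [k kE] : exists k, Num.truncn t = k.+1.
  by exists (Num.truncn t).-1; rewrite prednK.
have /andP[kt tk] := truncn_itv t0; rewrite kE in kt tk.
pose N d := Num.truncn (alpha d * k%:R).
have LS : (\sum_(d < b) N d)%:R <= S * k%:R :> R.
  rewrite natr_sum mulr_suml; apply: ler_sum => d _.
  by rewrite truncn_le mulr_ge0.
have bx : (b ^ (k + \sum_(d < b) N d).+1)%:R <= x.
  rewrite natrX -ler_ln ?posrE ?exprn_gt0// lnXn// -[ln _ *+ _]mulr_natl.
  rewrite tx /c mulrA ler_pM2r// -addSn natrD.
  have := ler_wpM2l S0 kt; rewrite -natr1 in kt *; lra.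
have lnL := fact_le_card_calN0 R b k N x b1 (admissible_truncn R b k alpha adm) bx.
have P0 : (0 < \prod_(d < b) (N d)`!)%N by apply: prodn_gt0 => d; exact: fact_gt0.
have C0 := card_calN0_gt0 R b x x1.
rewrite -(ler_nat R) -ler_ln ?posrE ?ltr0n ?fact_gt0 ?muln_gt0 ?P0 ?C0// in lnL.
rewrite natrM lnM ?posrE ?ltr0n// in lnL.
have lnP : ln ((\prod_(d < b) (N d)`!)%N%:R : R)
    = \sum_(d < b) ln ((N d)`!%:R : R).
  rewrite natr_prod; apply: (@proj1 _ (0 < \prod_(d < b) (N d)`!%:R :> R)).
  apply: (big_ind2 (fun y z : R => ln y = z /\ 0 < y)) => [|y1 z1 y2 z2|d _].
  - by rewrite ln1.
  - by move=> [<- ?] [<- ?]; rewrite lnM ?posrE// mulr_gt0.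
  - by rewrite ltr0n fact_gt0.
rewrite lnP in lnL.
have mult : k%:R * E - 4 * b%:R * (e * (S * k%:R) + K + 1)
    <= ln (((\sum_(d < b) N d)`!)%:R : R) - \sum_(d < b) ln ((N d)`!%:R : R).
  exact: ln_multinomial_ge a0 (ltW e0) K0 lnK.
have H1 : k%:R * E - 4 * b%:R * (e * (S * k%:R) + K + 1)
   <= ln (card_calN0 b x)%:R by lra.
apply: le_trans H1.
have -> : (E / c - delta) * ln x = t * E - delta * ln x.
  by rewrite tx; field; rewrite gt_eqF.
have eS : 4 * b%:R * (e * (S * k%:R)) <= delta * ln x / 2.
  have -> : delta * ln x / 2 = 4 * b%:R * (e * ((S + 1) * t)).
    by rewrite tx /e; field; rewrite !gt_eqF.
  rewrite ler_pM2l ?mulr_gt0// ler_pM2l//; apply: ler_pM => //; first by rewrite lerDl.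
  by apply: le_trans kt; rewrite ler_nat.
have kE2 : (t - 2) * E <= k%:R * E.
  rewrite ler_pM2r//; move: tk; rewrite -[k.+2%:R]natr1 -[k.+1%:R]natr1; lra.
rewrite ler_pdivrMr// in xd.
lra.
Unshelve. all: by end_near. Qed.

(** * Passage to the supremum *)

Theorem theorem3p1 (R : realType) (b : nat) (hb : (3 <= b)%N) :
  exists eps : R -> R,
    eps x @[x --> +oo] --> 0 /\
    \forall x \near +oo, x `^ (rho0 R b + eps x) < (card_calN0 b x)%:R.
Proof.
have b1 : (1 < b)%N by apply: leq_trans hb.
have lower delta : 0 < delta -> \forall x \near +oo,
    (rho0 R b - delta) * ln x <= ln ((card_calN0 b x)%:R : R).
  move=> d0; have d2 : 0 < delta / 2 by rewrite divr_gt0.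
  (* Half of [delta] approximates the supremum, the other half is the asymptotic loss for that
     [alpha]. *)
  have [_ [alpha adm <-] ra] := sup_adherent d2 (has_sup_rho0 R b1).
  near=> x.
  have x1 : 1 <= x by near: x; apply: nbhs_pinfty_ge; exact: num_real.
  apply: (@le_trans _ _ ((rho0_ratio alpha - delta / 2) * ln x)).
    by rewrite ler_wpM2r ?ln_ge0//; move: ra; rewrite -/(rho0 R b); lra.
  by near: x; apply: card_calN0_lower.
(* The term - 1 / ln x makes the inequality strict. *)
exists (fun x => Num.min (ln (card_calN0 b x)%:R / ln x - rho0 R b) 0 - (ln x)^-1).
split.
  apply/cvgrPdist_le => delta d0; near=> x.
  have d2 : 0 < delta / 2 by rewrite divr_gt0.
  have lx : 2 / delta <= ln x by near: x; exact: near_pinfty_le_ln.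
  have lx0 : 0 < ln x by apply: lt_le_trans lx; rewrite divr_gt0.
  have il : (ln x)^-1 <= delta / 2.
    by rewrite -[delta / 2]invrK lef_pV2 ?posrE ?invr_gt0// invf_div.
  have i0 : 0 < (ln x)^-1 by rewrite invr_gt0.
  have H : (rho0 R b - delta / 2) * ln x <= ln ((card_calN0 b x)%:R : R).
    by near: x; apply: lower; rewrite divr_gt0.
  rewrite -ler_pdivlMr// in H.
  (* The minimum with 0 makes the upper side immediate, so lower bounds on the count are enough for
     convergence. *)
  rewrite sub0r normrN ler_norml; apply/andP; split; last first.
    have : Num.min (ln (card_calN0 b x)%:R / ln x - rho0 R b) 0 <= 0.
      by rewrite ge_min lexx orbT.
    lra.
  have : - (delta / 2) <= Num.min (ln (card_calN0 b x)%:R / ln x - rho0 R b) 0.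
    by rewrite le_min; apply/andP; split; lra.
  lra.
near=> x.
have x1 : 1 <= x by near: x; apply: nbhs_pinfty_ge; exact: num_real.
have lx : 1 <= ln x by near: x; exact: near_pinfty_le_ln.
have lx0 : 0 < ln x by apply: lt_le_trans lx.
have x0 : 0 < x by apply: lt_le_trans x1.
rewrite -ltr_ln ?posrE ?powR_gt0 ?ltr0n ?card_calN0_gt0// ln_powR.
set m := Num.min _ _.
have m1 : m <= ln (card_calN0 b x)%:R / ln x - rho0 R b by rewrite ge_min lexx.
rewrite -ltr_pdivlMr//; have : 0 < (ln x)^-1 by rewrite invr_gt0.
lra.
Unshelve. all: by end_near. Qed.
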